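(* If $G$ is a graph that is not complete, then $\mu(D(G))\ge n(G)+\mu_t(G)$. Moreover, the bound is sharp, i.e., there exist non-complete graphs $G$ for which equality holds.
   Context: All graphs are finite and simple; $n(G)$ is the order of $G$. The double graph $D(G)$ is obtained from the disjoint union of $G$ and a copy $G'$ with $V(G')=\{u': u\in V(G)\}$ by joining each $u\in V(G)$ to all neighbors of $u'$ in $G'$ and each $u'$ to all neighbors of $u$ in $G$; thus $N_{D(G)}(u)=N_{D(G)}(u')$. Given $S\subseteq V(H)$, two vertices $x,y$ of $H$ are $S$-visible if some shortest $x,y$-path in $H$ has no internal vertex in $S$. $S$ is a mutual-visibility set if every two vertices of $S$ are $S$-visible; $\mu(H)$ is the maximum size of such a set. $S$ is a total mutual-visibility set if every two vertices of $H$ (in $S$ or not) are $S$-visible; $\mu_t(H)$ is the maximum size of such a set. *)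

(* Defs.v *)
From mathcomp Require Import all_boot.
From mathcomp Require Import boolp.

Set Implicit Arguments.
Unset Strict Implicit.
Unset Printing Implicit Defensive.

(* A finite simple graph is a finType of vertices with a symmetric irreflexive
   adjacency relation. *)
Definition simple_graph (T : finType) (e : rel T) : Prop :=
  symmetric e /\ irreflexive e.

Definition complete_graph (T : finType) (e : rel T) : Prop :=
  forall x y : T, x != y -> e x y.

(* inl u is the vertex u of G and inr u is its copy u' in G'. *)
Definition double_graph (T : finType) (e : rel T) : rel (T + T) :=
  fun a b => match a, b with
    | inl u, inl v => e u v
    | inr u, inr v => e u v
    | inl u, inr v => e u v
    | inr u, inl v => e u v
    end.

(* x :: p is the vertex sequence of the path, so its length is size p. *)
Definition shortest_path (T : finType) (e : rel T) (x y : T) (p : seq T) : Prop :=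
  [/\ path e x p, last x p = y &
      forall q : seq T, path e x q -> last x q = y -> size p <= size q].

(* x :: p without its first and last entries. *)
Definition internal_vertices (T : Type) (x : T) (p : seq T) : seq T :=
  behead (belast x p).

Definition visible (T : finType) (e : rel T) (S : {set T}) (x y : T) : Prop :=
  exists2 p : seq T, shortest_path e x y p &
    forall z : T, z \in internal_vertices x p -> z \notin S.

Definition mutual_visibility_set (T : finType) (e : rel T) (S : {set T}) : Prop :=
  forall x y : T, x \in S -> y \in S -> x != y -> visible e S x y.

Definition total_mutual_visibility_set (T : finType) (e : rel T) (S : {set T}) : Prop :=
  forall x y : T, x != y -> visible e S x y.

Definition is_max_size (T : finType) (P : {set T} -> Prop) (k : nat) : Prop :=
  (exists2 S : {set T}, P S & #|S| = k) /\
  (forall S : {set T}, P S -> #|S| <= k).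

Definition is_mu (T : finType) (e : rel T) (k : nat) : Prop :=
  is_max_size (mutual_visibility_set e) k.

(* A disconnected graph has no total mutual-visibility set at all (not even the
   empty set), so is_mu_t e k holds for no k: mu_t is then undefined. *)
Definition is_mu_t (T : finType) (e : rel T) (k : nat) : Prop :=
  is_max_size (total_mutual_visibility_set e) k.

Lemma is_max_size_uniq (T : finType) (P : {set T} -> Prop) (k l : nat) :
  is_max_size P k -> is_max_size P l -> k = l.
Proof.
move=> [[A PA <-] kmax] [[B PB <-] lmax].
by apply/eqP; rewrite eqn_leq kmax // lmax.
Qed.

Lemma is_max_size_ex (T : finType) (P : {set T} -> Prop) (S0 : {set T}) :
  P S0 -> exists k, is_max_size P k.
Proof.
move=> /asboolP PS0.
case: (@arg_maxnP _ S0 (fun S => `[< P S >]) (fun S => #|S|) PS0) => S PS Smax.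
exists #|S|; split; first by exists S => //; apply/asboolP.
by move=> B /asboolP; apply: Smax.
Qed.

Lemma is_mu_ex (T : finType) (e : rel T) : exists k, is_mu e k.
Proof. by apply: (@is_max_size_ex _ _ set0) => x y; rewrite inE. Qed.

Lemma simple_double_graph (T : finType) (e : rel T) :
  simple_graph e -> simple_graph (double_graph e).
Proof.
by move=> [esym eirr]; split=> [[u|u] [v|v]|[u|u]] /=; rewrite ?eirr // esym.
Qed.

(* Main.v *)
Require Import Defs.
From mathcomp Require Import all_boot.
From mathcomp Require Import boolp.

Set Implicit Arguments.
Unset Strict Implicit.
Unset Printing Implicit Defensive.

(** If [S] is a total mutual-visibility set of [G], then the whole copy [V(G')]
    together with [S] in [V(G)] is a mutual-visibility set of [D(G)]: between
    vertices with distinct projections, a shortest path of [G] avoiding [S] lifts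
    to one whose internal vertices all lie in [V(G) \ S], and the twins [u], [u']
    with [u] in [S] see each other through a neighbour of [u] outside [S], which
    exists as [G] is not complete.  The bound is attained by the path on three
    vertices. *)

Section Visibility.
Context {T : finType} {e : rel T}.

Lemma visible_edge (S : {set T}) x y : x != y -> e x y -> visible e S x y.
Proof.
move=> xy exy; exists [:: y] => //; split=> [|//|[|z q] _ //=].
  by rewrite /= exy.
by move=> xyE; rewrite xyE eqxx in xy.
Qed.

(** The path through [w] is shortest because distinct nonadjacent vertices are joined by no path of
    length 0 or 1. *)
Lemma visible_common_neighbor (S : {set T}) x y w :
  x != y -> ~~ e x y -> e x w -> e w y -> w \notin S -> visible e S x y.
Proof.
move=> xy nexy exw ewy wS; exists [:: w; y]; last first.
  by move=> z; rewrite mem_seq1 => /eqP->.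
split=> [|//|[|z [|z' q]] //=]; first by rewrite /= exw ewy.
  by move=> _ xyE; rewrite xyE eqxx in xy.
by rewrite andbT => exz zy; rewrite -zy exz in nexy.
Qed.

(** A path from [x] to [y] has at least two edges here, so the vertex following [x] is internal. *)
Lemma visible_free_neighbor (S : {set T}) x y :
  x != y -> ~~ e x y -> visible e S x y -> exists2 w, e x w & w \notin S.
Proof.
move=> xy nexy [[|w p] [/= ewp lp _] pS].
  by rewrite lp eqxx in xy.
have /andP[exw _] := ewp; exists w => //; apply: pS.
case: p lp {ewp} => [wy|z p _]; last by rewrite mem_head.
by rewrite -wy exw in nexy.
Qed.

Lemma not_completeP :
  ~ complete_graph e -> exists x y : T, x != y /\ ~~ e x y.
Proof.
move=> nc; apply/not_existsP => H; apply: nc => x y xy.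
by apply: contrapT => /negP nexy; apply: (H x); exists y.
Qed.

(** A nonadjacent pair would need an internal vertex outside the whole vertex set. This gives both
    upper bounds in the sharpness example. *)
Lemma setT_not_mutual_visibility :
  ~ complete_graph e -> ~ mutual_visibility_set e setT.
Proof.
move=> /not_completeP[x [y [xy nexy]]] mvT.
have [w _] := visible_free_neighbor xy nexy (mvT x y (in_setT _) (in_setT _) xy).
by rewrite in_setT.
Qed.

(** If [u] has a non-neighbour, a path towards it starts with a suitable [w]. Otherwise [u] is
    adjacent to all other vertices, and any nonadjacent pair yields some [w] outside [S], which
    differs from [u] since [u] lies in [S]. *)
Lemma total_mutual_visibility_free_neighbor (S : {set T}) u :
  symmetric e -> ~ complete_graph e -> total_mutual_visibility_set e S ->
  u \in S -> exists2 w, e u w & w \notin S.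
Proof.
move=> esym /not_completeP[x [y [xy nexy]]] tS uS.
have [/existsP[v /andP[uv neuv]]|/existsPn univ] :=
  boolP [exists v, (u != v) && ~~ e u v].
  exact: visible_free_neighbor uv neuv (tS _ _ uv).
have [w exw wS] := visible_free_neighbor xy nexy (tS _ _ xy).
exists w => //; have := univ w; rewrite negb_and !negbK => /orP[/eqP uw|//].
by rewrite -uw uS in wS.
Qed.

End Visibility.

Section DoubleGraph.
Context {T : finType} {e : rel T}.

(** The projection of D(G) onto G, with the twin pairs as fibres. Adjacency in D(G) is pulled back
    along it, so walks project to walks of the same length. *)
Definition base (a : T + T) : T := match a with inl u | inr u => u end.

Lemma double_graphE : double_graph e =2 relpre base e.
Proof. by case=> u [v|v]. Qed.

Lemma path_double_graph a q :
  path (double_graph e) a q = path e (base a) (map base q).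
Proof. by rewrite path_map; apply: eq_path; apply: double_graphE. Qed.

Definition double_set (S : {set T}) : {set T + T} :=
  [set a | if a is inl u then u \in S else true].

Lemma card_double_set (S : {set T}) : #|double_set S| = #|T| + #|S|.
Proof.
have -> : double_set S = inl @: S :|: inr @: [set: T].
  apply/setP => -[u|u]; rewrite !inE.
    rewrite mem_imset; last exact: inl_inj.
    by apply/esym/orb_idr => /imsetP[].
  by rewrite [X in _ || X]mem_imset ?inE ?orbT //; apply: inr_inj.
rewrite cardsU disjoint_setI0 ?cards0 ?subn0; last first.
  by apply/pred0P => a; apply/andP => -[/imsetP[u _ ->] /imsetP[]].
by rewrite (card_imset _ (@inl_inj _ _)) (card_imset _ (@inr_inj _ _)) cardsT addnC.
Qed.

Lemma visible_double_graph (S : {set T}) a b :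
  base a != base b -> visible e S (base a) (base b) ->
  visible (double_graph e) (double_set S) a b.
Proof.
move=> ab [p [ep lp minp] pS].
(* The last vertex is split off because it must lift to [b] itself, whichever copy [b] is in, while
   the internal vertices lift by [inl]. *)
case/lastP: p => [|p v] in ep lp minp pS.
  by rewrite /= in lp; rewrite lp eqxx in ab.
rewrite last_rcons in lp; rewrite {}lp in ep minp pS.
have baseK s : map base (map inl s) = s by rewrite -map_comp map_id.
exists (rcons (map inl p) b).
  split; first by rewrite path_double_graph map_rcons baseK.
    by rewrite last_rcons.
  move=> q; rewrite path_double_graph => eq lq.
  have := minp _ eq; rewrite last_map lq => /(_ erefl).
  by rewrite !size_rcons !size_map.
move=> z; rewrite /internal_vertices belast_rcons /= => /mapP[w wp ->].
by rewrite inE; apply: pS; rewrite /internal_vertices belast_rcons.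
Qed.

Lemma mutual_visibility_double_set (S : {set T}) :
  simple_graph e -> ~ complete_graph e -> total_mutual_visibility_set e S ->
  mutual_visibility_set (double_graph e) (double_set S).
Proof.
move=> [esym eirr] nc tS a b aS bS ab.
have [abE|nab] := eqVneq (base a) (base b); last first.
  by apply: visible_double_graph => //; apply: tS.
(* Distinct vertices with the same projection are twins; the one of the form [inl u] lies in
   [double_set S] only if [u] is in [S]. *)
have uS : base a \in S.
  by case: a b aS bS ab abE => u [v|v] /=; rewrite !inE // => ? ? + uv;
     rewrite uv ?eqxx // -uv.
have [w euw wS] := total_mutual_visibility_free_neighbor esym nc tS uS.
apply: (@visible_common_neighbor _ _ _ _ _ (inl w)) => //.
- by rewrite double_graphE /= abE eirr.
- by rewrite double_graphE.
- by rewrite double_graphE /= -abE esym.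
- by rewrite inE.
Qed.

Lemma double_graph_not_complete :
  ~ complete_graph e -> ~ complete_graph (double_graph e).
Proof. by move=> nc cD; apply: nc => x y xy; apply: (cD (inl x) (inl y)). Qed.

Lemma mu_double_graph_ge m mt :
  simple_graph e -> ~ complete_graph e ->
  is_mu (double_graph e) m -> is_mu_t e mt -> #|T| + mt <= m.
Proof.
move=> sg nc [_ maxm] [[S tS <-] _]; rewrite -card_double_set.
by apply: maxm; apply: mutual_visibility_double_set.
Qed.

End DoubleGraph.

Lemma card_lt_not_setT (U : finType) (P : {set U} -> Prop) (S : {set U}) :
  ~ P setT -> P S -> #|S| < #|U|.
Proof.
move=> nPT PS; rewrite -cardsT proper_card // properT.
by apply: contra_notN nPT => /eqP <-.
Qed.

(* The path on three vertices, with middle vertex [None]. *)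
Definition path3 : rel (option bool) := fun x y => isSome x (+) isSome y.

Lemma simple_path3 : simple_graph path3.
Proof. by split=> [[x|] [y|]|[x|]]. Qed.

Lemma path3_not_complete : ~ complete_graph path3.
Proof. by move=> /(_ (Some true) (Some false) isT). Qed.

Lemma total_mutual_visibility_path3 :
  total_mutual_visibility_set path3 [set~ None].
Proof.
move=> x y xy; have [exy|nexy] := boolP (path3 x y).
  exact: visible_edge.
apply: (@visible_common_neighbor _ _ _ _ _ None) => //.
- by case: x y xy nexy => [x|] [y|].
- by case: x y xy nexy => [x|] [y|].
- by rewrite !inE.
Qed.

Lemma is_mu_t_path3 : is_mu_t path3 2.
Proof.
split; first exists [set~ None].
- exact: total_mutual_visibility_path3.
- by rewrite cardsC1 card_option card_bool.
(* Three vertices in all, so it suffices to exclude the full vertex set. *)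
- move=> S tS; rewrite -ltnS.
  suff : #|S| < #|{: option bool}| by rewrite card_option card_bool.
  apply: card_lt_not_setT tS => tT.
  apply: (setT_not_mutual_visibility path3_not_complete) => x y _ _.
  exact: tT.
Qed.

Theorem theorem3p2 :
  (forall (T : finType) (e : rel T),
     simple_graph e -> ~ complete_graph e ->
     forall m mt : nat,
       is_mu (double_graph e) m -> is_mu_t e mt -> #|T| + mt <= m) /\
  (exists (T : finType) (e : rel T) (m mt : nat),
     [/\ simple_graph e, ~ complete_graph e,
         is_mu (double_graph e) m, is_mu_t e mt & m = #|T| + mt]).
Proof.
split=> [T e sg nc m mt|]; first exact: mu_double_graph_ge.
have [m mum] := is_mu_ex (double_graph path3).
exists (option bool), path3, m, 2; split=> //.
- exact: simple_path3.
- exact: path3_not_complete.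
- exact: is_mu_t_path3.
apply/eqP; rewrite eqn_leq andbC.
rewrite (mu_double_graph_ge simple_path3 path3_not_complete mum is_mu_t_path3).
(* What remains is the bound 5 = 3 + 2 from above: the double graph has six vertices and is not
   complete, so its full vertex set is excluded. *)
case: mum => -[S mvS <-] _; rewrite card_option card_bool -ltnS.
suff : #|S| < #|{: option bool + option bool}|.
  by rewrite card_sum card_option card_bool.
apply: card_lt_not_setT mvS.
exact: setT_not_mutual_visibility (double_graph_not_complete path3_not_complete).
Qed.
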